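(* Let $\boldsymbol\phi_t$ be a smooth motion with velocity $u^i$, deformation gradient $F^i_\alpha$ and density $\rho=\hat\rho/|F|$. Let $c=(c^{ij})$ be a smooth field with values in $S^{++}(\mathbb R^{d\times d})$ and let $A^{\alpha\beta}=[F^{-1}]^\alpha_i c^{ij}[F^{-1}]^\beta_j\in S^{++}(\mathbb R^{d\times d})$. Then $(u,F,\rho,c)$ is a solution of the isothermal compressible Upper-Convected Maxwell (UCM) model $$\begin{aligned} &\partial_t(\rho u^i)+\partial_j\big(\rho u^ju^i-\sigma^{ij}\big)=\rho f^i,\qquad \sigma^{ij}=-p\,\delta_{ij}+2\rho\,(K\mathcal H' c^{ij}-k_B\theta\,\delta_{ij}),\\ &\partial_t(\rho F^i_\alpha)+\partial_j(\rho u^jF^i_\alpha-\rho F^j_\alpha u^i)=0,\\ &\partial_t\rho+\partial_j(\rho u^j)=0,\\ &\partial_t c^{ij}+u^k\partial_kc^{ij}-(\partial_ku^i)c^{kj}-c^{ik}\partial_ku^j=-\tfrac{4K\mathcal H'}{\xi}c^{ij}+\tfrac{4k_B\theta}{\xi}\delta_{ij} \end{aligned}$$ if and only if $(u,F,\rho,A)$ is a solution of the system of conservation laws with algebraic source terms $$\begin{aligned} &\partial_t(\rho u^i)+\partial_j(\rho u^ju^i)-\partial_j\Big(-p\,\delta_{ij}+2\rho\,(K\mathcal H' F^i_\alpha A^{\alpha\beta}F^j_\beta-k_B\theta\,\delta_{ij})\Big)=\rho f^i,\\ &\partial_t(\rho F^i_\alpha)+\partial_j(\rho u^jF^i_\alpha-\rho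 u^iF^j_\alpha)=0,\\ &\partial_t\rho+\partial_i(\rho u^i)=0,\\ &\partial_t(\rho A^{\alpha\beta})+\partial_j(\rho u^jA^{\alpha\beta})=\frac{4\rho}{\xi}\Big(k_B\theta\,[F^{-1}]^\alpha_i[F^{-1}]^\beta_i-K\mathcal H'A^{\alpha\beta}\Big). \end{aligned}$$ Furthermore, such solutions satisfy $$\partial_tE+\partial_j(u^jE)-\partial_j(u^i\sigma^{ij})=\rho f^iu^i-\frac{4\rho}{\xi}\mathcal D,\qquad E=\rho\Big(\frac{|u|^2}{2}+\psi\Big),$$ where $$\begin{aligned} \psi&=e_0(\rho)+K\mathcal H'F^i_\alpha F^i_\beta A^{\alpha\beta}-k_B\theta\log\big|FAF^T\big|\\ &=e_0(\rho)+K\mathcal H'F^i_\alpha F^i_\beta A^{\alpha\beta}+2k_B\theta\log(\rho/\hat\rho)-k_B\theta\log|A|, \end{aligned}$$ $\sigma^{ij}=-p\,\delta_{ij}+2\rho F^i_\alpha F^j_\beta\,\partial_{F^k_\alpha F^k_\beta}\psi$ (the derivative of the first expression of $\psi$ with respect to the tensor $C_{\alpha\beta}=F^k_\alpha F^k_\beta$ at fixed $\rho$ and $A$, using $|FAF^T|=|C||A|$), and, with $c=FAF^T$, $$\mathcal D=(K\mathcal H'c^{ij}-k_B\theta\,\delta_{ij})\,[c^{-1}]_{jk}\,(K\mathcal H'c^{ik}-k_B\theta\,\delta_{ik})\ \ge 0 .$$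
   Context: Repeated indices are summed; $d\in\{2,3\}$. Latin indices refer to spatial Cartesian coordinates $x^i$, Greek indices to material Cartesian coordinates $a^\alpha$. $|M|$ denotes the determinant of a matrix $M$; $S^{++}(\mathbb R^{d\times d})$ is the set of symmetric positive definite matrices. A smooth motion is a smooth time-indexed family of diffeomorphisms $\boldsymbol\phi_t:a\mapsto x=\boldsymbol\phi_t(a)\in\mathbb R^d$ with smooth inverses and positive Jacobian determinant; its velocity is $u^i=\partial_t\phi^i_t\circ\boldsymbol\phi_t^{-1}$, its deformation gradient is $F^i_\alpha=\partial_{a^\alpha}\phi^i_t\circ\boldsymbol\phi_t^{-1}$, and its mass density is $\rho=\hat\rho\,|F|^{-1}$ with $\hat\rho>0$ a constant. (In particular Piola's identities $\partial_j(|F|^{-1}F^j_\alpha)=0$ hold.) $K,\mathcal H',k_B,\theta,\xi$ are positive constants (isothermal case: $\theta$ constant), $f^i$ is a given smooth body force field, $e_0(\rho)$ is a given smooth function, and the pressure is $p=-\partial_{\rho^{-1}}e_0$ (derivative of $e_0$ regarded as a function of $\rho^{-1}$). *)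

(* Defs.v *)
From HB Require Import structures.
From mathcomp Require Import all_boot all_order all_algebra.
From mathcomp Require Import all_classical all_reals all_analysis.

Set Implicit Arguments.
Unset Strict Implicit.
Unset Printing Implicit Defensive.

Import Order.TTheory GRing.Theory Num.Theory.
Import numFieldNormedType.Exports.

Local Open Scope classical_set_scope.
Local Open Scope ring_scope.

(* [smooth_on U f]: f is C^oo on U.  Meaningful for open U only; the values of
   f outside U are then irrelevant. *)
Fixpoint Ck_on (R : realType) (V : normedModType R) (U : set V) (k : nat)
    (f : V -> R) : Prop :=
  match k with
  | 0%N => forall x, U x -> {for x, continuous f}
  | k'.+1 => (forall x, U x -> differentiable f x) /\
             forall v : V, Ck_on U k' (fun x => 'D_v f x)
  end.

Definition smooth_on (R : realType) (V : normedModType R) (U : set V)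
  (f : V -> R) : Prop := forall k, Ck_on U k f.

Definition spd (R : realType) (d : nat) (M : 'M[R]_d) : Prop :=
  M^T = M /\ forall v : 'cV[R]_d, v != 0 -> 0 < (v^T *m M *m v) 0 0.

(* Points (t, x) or (t, a). *)
Notation spacetime R d := (R * 'rV[R]_d)%type.

Definition dt (R : realType) (d : nat) (g : spacetime R d -> R)
  (z : spacetime R d) : R := 'D_((1, 0) : spacetime R d) g z.

Definition dx (R : realType) (d : nat) (j : 'I_d) (g : spacetime R d -> R)
  (z : spacetime R d) : R := 'D_((0, delta_mx 0 j) : spacetime R d) g z.

Section Motion.
Context (R : realType) (d : nat).
(* [phi (t, a)] is the position at time t of the material point a, and
   [phinv (t, x)] the label of the material point at x at time t. *)
Implicit Types (phi phinv : spacetime R d -> 'rV[R]_d).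

Definition occupied (J : set R) (B : set 'rV[R]_d) phi : set (spacetime R d) :=
  [set z | J z.1 /\ exists2 a, B a & phi (z.1, a) = z.2].

Definition material_gradient phi (y : spacetime R d) : 'M[R]_d :=
  \matrix_(i, al) dx al (fun y' => phi y' 0 i) y.

Record smooth_motion (J : set R) (B : set 'rV[R]_d) phi phinv : Prop := {
  motion_times_open : open J;
  motion_body_open : open B;
  motion_smooth : forall i, smooth_on (J `*` B) (fun y => phi y 0 i);
  motion_inverse : forall t a, J t -> B a -> phinv (t, phi (t, a)) = a;
  motion_range_open : open (occupied J B phi);
  motion_inverse_smooth :
    forall al, smooth_on (occupied J B phi) (fun z => phinv z 0 al);
  motion_jacobian_gt0 :
    forall t a, J t -> B a -> 0 < \det (material_gradient phi (t, a)) }.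

Definition velocity phi phinv (z : spacetime R d) : 'rV[R]_d :=
  \row_i dt (fun y => phi y 0 i) (z.1, phinv z).

Definition deformation_gradient phi phinv (z : spacetime R d) : 'M[R]_d :=
  material_gradient phi (z.1, phinv z).

Definition mass_density (rhohat : R) phi phinv (z : spacetime R d) : R :=
  rhohat / \det (deformation_gradient phi phinv z).

End Motion.

(* [Hp] is the derivative $\mathcal H'$, a constant here. *)
Record maxwell_constants (R : realType) := MaxwellConstants {
  K : R; Hp : R; kB : R; theta : R; xi : R }.

Definition positive_constants (R : realType) (m : maxwell_constants R) : Prop :=
  [/\ 0 < K m, 0 < Hp m, 0 < kB m, 0 < theta m & 0 < xi m].

Section Maxwell.
Context (R : realType) (d : nat).
Implicit Types (m : maxwell_constants R).
Implicit Types (Om : set (spacetime R d)) (f u : spacetime R d -> 'rV[R]_d).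
Implicit Types (F A c : spacetime R d -> 'M[R]_d) (rho : spacetime R d -> R).

Definition pressure (e0 : R -> R) (r : R) : R :=
  - derive1 (fun v : R => e0 v^-1) r^-1.

Definition stress m (e0 : R -> R) (r : R) (C : 'M[R]_d) : 'M[R]_d :=
  - pressure e0 r *: 1%:M
  + (2 * r) *: ((K m * Hp m) *: C - (kB m * theta m) *: 1%:M).

Definition ucm_solution m (e0 : R -> R) f Om u F rho c : Prop :=
  forall z, Om z -> [/\
    forall i : 'I_d,
      dt (fun y => rho y * u y 0 i) z
      + \sum_j dx j (fun y => rho y * u y 0 j * u y 0 i
                              - stress m e0 (rho y) (c y) i j) z
      = rho z * f z 0 i,
    forall i al : 'I_d,
      dt (fun y => rho y * F y i al) z
      + \sum_j dx j (fun y => rho y * u y 0 j * F y i al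
                              - rho y * F y j al * u y 0 i) z
      = 0,
    dt rho z + \sum_j dx j (fun y => rho y * u y 0 j) z = 0
  & forall i j : 'I_d,
      dt (fun y => c y i j) z
      + \sum_k u z 0 k * dx k (fun y => c y i j) z
      - \sum_k dx k (fun y => u y 0 i) z * c z k j
      - \sum_k c z i k * dx k (fun y => u y 0 j) z
      = - (4 * K m * Hp m / xi m) * c z i j
        + 4 * kB m * theta m / xi m * (i == j)%:R ].

Definition conservation_law_solution m (e0 : R -> R) f Om u F rho A : Prop :=
  forall z, Om z -> [/\
    forall i : 'I_d,
      dt (fun y => rho y * u y 0 i) z
      + \sum_j dx j (fun y => rho y * u y 0 j * u y 0 i) z
      - \sum_j dx j (fun y =>
          stress m e0 (rho y) (F y *m A y *m (F y)^T) i j) z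
      = rho z * f z 0 i,
    forall i al : 'I_d,
      dt (fun y => rho y * F y i al) z
      + \sum_j dx j (fun y => rho y * u y 0 j * F y i al
                              - rho y * u y 0 i * F y j al) z
      = 0,
    dt rho z + \sum_i dx i (fun y => rho y * u y 0 i) z = 0
  & forall al be : 'I_d,
      dt (fun y => rho y * A y al be) z
      + \sum_j dx j (fun y => rho y * u y 0 j * A y al be) z
      = 4 * rho z / xi m
        * (kB m * theta m
             * \sum_i invmx (F z) al i * invmx (F z) be i
           - K m * Hp m * A z al be) ].

Definition pulled_back_conformation F c (z : spacetime R d) : 'M[R]_d :=
  invmx (F z) *m c z *m (invmx (F z))^T.

Definition free_energy m (e0 : R -> R) (r : R) (G A : 'M[R]_d) : R :=
  e0 r
  + K m * Hp m * (\sum_i \sum_al \sum_be G i al * G i be * A al be)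
  - kB m * theta m * ln (\det (G *m A *m G^T)).

Definition free_energy_of_density m (e0 : R -> R) (rhohat r : R)
    (G A : 'M[R]_d) : R :=
  e0 r
  + K m * Hp m * (\sum_i \sum_al \sum_be G i al * G i be * A al be)
  + 2 * kB m * theta m * ln (r / rhohat)
  - kB m * theta m * ln (\det A).

(* [free_energy] as a function of the tensor C = G^T G. *)
Definition free_energy_of_strain m (e0 : R -> R) (r : R) (A C : 'M[R]_d) : R :=
  e0 r
  + K m * Hp m * (\sum_al \sum_be C al be * A al be)
  - kB m * theta m * ln (\det C * \det A).

(* The derivative with respect to the tensor C at G^T G is taken entrywise, the
   d^2 entries of C being treated as independent. *)
Definition hyperelastic_stress m (e0 : R -> R) (r : R) (G A : 'M[R]_d) :
    'M[R]_d :=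
  \matrix_(i, j) (- pressure e0 r * (i == j)%:R
    + 2 * r * \sum_al \sum_be G i al * G j be
        * 'D_(delta_mx al be : 'M[R]_d)
            (free_energy_of_strain m e0 r A : 'M[R]_d -> R) (G^T *m G)).

Definition total_energy m (e0 : R -> R) u F rho A (z : spacetime R d) : R :=
  rho z * ((\sum_i u z 0 i ^+ 2) / 2 + free_energy m e0 (rho z) (F z) (A z)).

Definition dissipation m (C : 'M[R]_d) : R :=
  let S := (K m * Hp m) *: C - (kB m * theta m) *: 1%:M in
  \sum_i \sum_j \sum_k S i j * invmx C j k * S i k.

Definition energy_balance m (e0 : R -> R) f Om u F rho A : Prop :=
  forall z, Om z ->
    let E := total_energy m e0 u F rho A in
    let c := fun y => F y *m A y *m (F y)^T in
    dt E z + \sum_j dx j (fun y => u y 0 j * E y) z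
    - \sum_j dx j (fun y =>
        \sum_i u y 0 i * stress m e0 (rho y) (c y) i j) z
    = \sum_i rho z * f z 0 i * u z 0 i
      - 4 * rho z / xi m * dissipation m (c z).

End Maxwell.

(* Main.v *)
(* Symmetry of second derivatives of the motion shows that [F] is transported by
   the flow: D_t F = (grad u) F, where D_t is the derivative along (1, u).  Hence,
   for c = F A F^T,
     D_t c - (grad u) c - c (grad u)^T = F (D_t A) F^T,
   which exchanges the upper-convected equation for c with the ordinary
   differential equation for A along trajectories, whose conservative form follows
   from conservation of mass.  For the energy, E = rho e with
     e = |u|^2 / 2 + e0(rho) + K H' tr c - kB theta ln (det c),
   so the balance is rho D_t e.  Momentum contributes u . div sigma, mass
   contributes - p div u through p = rho^2 e0'(rho), and by Jacobi's formula the
   c-dependent part contributes (K H' I - kB theta c^-1) : D_t c; the convected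
   part of D_t c gives the elastic stress power and the relaxation part gives the
   dissipation. *)

Require Import Defs.
From HB Require Import structures.
From mathcomp Require Import all_boot all_order all_algebra.
From mathcomp Require Import all_classical all_reals all_analysis.
From mathcomp Require Import ring lra.

Set Implicit Arguments.
Unset Strict Implicit.
Unset Printing Implicit Defensive.

Import Order.TTheory GRing.Theory Num.Theory.
Import numFieldNormedType.Exports.

Local Open Scope classical_set_scope.
Local Open Scope ring_scope.

(** * Directional derivatives *)

Section DirectionalDerivative.
Context (R : realType) (V : normedModType R).
Implicit Types (f g : V -> R) (v z : V).

Lemma derive_fD f g v z : differentiable f z -> differentiable g z ->
  'D_v (fun y => f y + g y) z = 'D_v f z + 'D_v g z.
Proof. by move=> df dg; apply: deriveD; apply: diff_derivable. Qed.

Lemma derive_fB f g v z : differentiable f z -> differentiable g z ->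
  'D_v (fun y => f y - g y) z = 'D_v f z - 'D_v g z.
Proof. by move=> df dg; apply: deriveB; apply: diff_derivable. Qed.

Lemma derive_fM f g v z : differentiable f z -> differentiable g z ->
  'D_v (fun y => f y * g y) z = 'D_v f z * g z + f z * 'D_v g z.
Proof.
move=> df dg; rewrite addrC [_ * g z]mulrC.
by apply: (@deriveM R V f g); apply: diff_derivable.
Qed.

Lemma derive_fMl (k : R) f v z : differentiable f z ->
  'D_v (fun y => k * f y) z = k * 'D_v f z.
Proof.
move=> df; rewrite (derive_fM (f := fun=> k)) //.
by rewrite derive_cst mul0r add0r.
Qed.

Lemma differentiable_fsum (I : Type) (r : seq I) (P : pred I) (h : I -> V -> R) z :
  (forall i, P i -> differentiable (h i) z) ->
  differentiable (fun y => \sum_(i <- r | P i) h i y) z.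
Proof.
move=> dh; elim: r => [|i r IH].
  under eq_fun do rewrite big_nil.
  exact: differentiable_cst.
under eq_fun do rewrite big_cons.
case: (boolP (P i)) => Pi //.
by apply: differentiableD => //; exact: dh.
Qed.

Lemma derive_fsum (I : Type) (r : seq I) (P : pred I) (h : I -> V -> R) v z :
  (forall i, P i -> differentiable (h i) z) ->
  'D_v (fun y => \sum_(i <- r | P i) h i y) z = \sum_(i <- r | P i) 'D_v (h i) z.
Proof.
move=> dh; elim: r => [|i r IH].
  under eq_fun do rewrite big_nil.
  by rewrite big_nil derive_cst.
under eq_fun do rewrite big_cons.
rewrite big_cons; case: (boolP (P i)) => Pi //.
by rewrite derive_fD ?IH //; [exact: dh | exact: differentiable_fsum].
Qed.

Lemma differentiable_fprod (I : Type) (r : seq I) (P : pred I) (h : I -> V -> R) z :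
  (forall i, P i -> differentiable (h i) z) ->
  differentiable (fun y => \prod_(i <- r | P i) h i y) z.
Proof.
move=> dh; elim: r => [|i r IH].
  under eq_fun do rewrite big_nil.
  exact: differentiable_cst.
under eq_fun do rewrite big_cons.
case: (boolP (P i)) => Pi //.
by apply: differentiableM => //; exact: dh.
Qed.

Lemma derive_fprod (I : finType) (h : I -> V -> R) v z :
  (forall i, differentiable (h i) z) ->
  'D_v (fun y => \prod_i h i y) z
  = \sum_i 'D_v (h i) z * \prod_(k | k != i) h k z.
Proof.
move=> dh.
(* The induction runs over duplicate-free lists: with repetitions, the filter [k != i] would discard
   every copy of [i] instead of a single one. *)
suff gen (r : seq I) : uniq r -> 'D_v (fun y => \prod_(i <- r) h i y) z
    = \sum_(i <- r) 'D_v (h i) z * \prod_(k <- r | k != i) h k z.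
  by rewrite gen ?index_enum_uniq.
elim: r => [|i r IH] /=.
  under eq_fun do rewrite big_nil.
  by rewrite big_nil derive_cst.
case/andP=> ir ur.
under eq_fun do rewrite big_cons.
rewrite big_cons derive_fM //; last exact: differentiable_fprod.
rewrite IH // big_cons eqxx /= big_distrr /=; congr (_ * _ + _).
  rewrite big_seq [RHS]big_seq_cond; apply: eq_bigl => k.
  by case: (boolP (k \in r)) => //= kr; apply/esym; apply: contraNneq ir => <-.
rewrite [LHS]big_seq [RHS]big_seq; apply: eq_bigr => j jr.
rewrite big_cons ifT; last by apply: contraNneq ir => ->.
by rewrite mulrCA.
Qed.

(** A derivative depends only on the germ at [z]. This serves identities, such as [c = F A F^T],
    that hold only on an open set. *)
Lemma eq_on_derive (W : normedModType R) (U : set V) (f g : V -> W) v z : open U ->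
  U z -> (forall y, U y -> f y = g y) -> 'D_v f z = 'D_v g z.
Proof.
move=> oU Uz fg; apply: near_eq_derive.
by near=> y; apply: fg; near: y; exact: open_nbhs_nbhs.
Unshelve. all: by end_near. Qed.

Lemma derive_fcomp (W X : normedModType R) (f : V -> W) (g : W -> X) v z :
  differentiable f z -> differentiable g (f z) ->
  'D_v (fun y => g (f y)) z = 'D_('D_v f z) g (f z).
Proof.
move=> df dg; rewrite (@deriveE _ _ _ (g \o f)); last exact: differentiable_comp.
by rewrite diff_comp //= !deriveE.
Qed.

(** Linearity in the direction is that of the differential; existence of directional derivatives
    alone would not give it. *)
Lemma derive_dirD (W : normedModType R) (f : V -> W) v w z : differentiable f z ->
  'D_(v + w) f z = 'D_v f z + 'D_w f z.
Proof. by move=> df; rewrite !deriveE // linearD. Qed.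

Lemma derive_dirZ (W : normedModType R) (f : V -> W) (k : R) v z : differentiable f z ->
  'D_(k *: v) f z = k *: 'D_v f z.
Proof. by move=> df; rewrite !deriveE // linearZ. Qed.

Lemma derive_dir_sum (W : normedModType R) (f : V -> W) n (w : 'I_n -> V) z :
    differentiable f z ->
  'D_(\sum_i w i) f z = \sum_i 'D_(w i) f z.
Proof.
move=> df; rewrite deriveE // linear_sum; apply: eq_bigr => i _.
by rewrite deriveE.
Qed.

End DirectionalDerivative.

(** * Matrix-valued functions: products, traces and determinants *)

Section MatrixDerivative.
Context (R : realType) (V : normedModType R).
Implicit Types (v z : V).

Lemma differentiable_entry m n (M : V -> 'M[R]_(m, n)) z i j :
  differentiable M z -> differentiable (fun y => M y i j) z.
Proof.
move=> dM; apply: (@differentiable_comp _ _ _ _ M (fun A => A i j)) => //.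
exact: differentiable_coord.
Qed.

Lemma differentiable_mx m n (M : V -> 'M[R]_(m, n)) z :
  (forall i j, differentiable (fun y => M y i j) z) -> differentiable M z.
Proof.
move=> dM.
have -> : M = \sum_i \sum_j (fun y => M y i j *: delta_mx i j).
  apply/funext => y; rewrite fct_sumE [LHS]matrix_sum_delta.
  by apply: eq_bigr => i _; rewrite fct_sumE.
do 2!(apply: differentiable_sum => ?); exact: differentiableZl.
Qed.

Lemma derive_mxE m n (M : V -> 'M[R]_(m, n)) v z i j : differentiable M z ->
  ('D_v M z) i j = 'D_v (fun y => M y i j) z.
Proof. by move=> dM; rewrite derive_mx ?mxE //; exact: diff_derivable. Qed.

Lemma differentiable_mulmx m n p (M : V -> 'M[R]_(m, n)) (N : V -> 'M[R]_(n, p)) z :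
  differentiable M z -> differentiable N z ->
  differentiable (fun y => M y *m N y) z.
Proof.
move=> dM dN; apply: differentiable_mx => i j.
under eq_fun do rewrite mxE.
by apply: differentiable_fsum => k _; apply: differentiableM; apply: differentiable_entry.
Qed.

Lemma derive_mulmx m n p (M : V -> 'M[R]_(m, n)) (N : V -> 'M[R]_(n, p)) v z :
  differentiable M z -> differentiable N z ->
  'D_v (fun y => M y *m N y) z = 'D_v M z *m N z + M z *m 'D_v N z.
Proof.
move=> dM dN; apply/matrixP => i j.
rewrite derive_mxE; last exact: differentiable_mulmx.
under eq_fun do rewrite mxE.
rewrite derive_fsum; last first.
  by move=> k _; apply: differentiableM; apply: differentiable_entry.
rewrite !mxE -big_split; apply: eq_bigr => k _ /=.
by rewrite derive_fM ?derive_mxE //; apply: differentiable_entry.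
Qed.

Lemma differentiable_trmx m n (M : V -> 'M[R]_(m, n)) z :
  differentiable M z -> differentiable (fun y => (M y)^T) z.
Proof.
move=> dM; apply: differentiable_mx => i j; under eq_fun do rewrite mxE.
exact: differentiable_entry.
Qed.

Lemma derive_trmx m n (M : V -> 'M[R]_(m, n)) v z : differentiable M z ->
  'D_v (fun y => (M y)^T) z = ('D_v M z)^T.
Proof.
move=> dM; apply/matrixP => i j; rewrite derive_mxE; last exact: differentiable_trmx.
by under eq_fun do rewrite mxE; rewrite mxE derive_mxE.
Qed.

Lemma differentiable_trace n (M : V -> 'M[R]_n) z :
  differentiable M z -> differentiable (fun y => \tr (M y)) z.
Proof.
by move=> dM; apply: differentiable_fsum => i _; apply: differentiable_entry.
Qed.

Lemma derive_trace n (M : V -> 'M[R]_n) v z : differentiable M z ->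
  'D_v (fun y => \tr (M y)) z = \tr ('D_v M z).
Proof.
move=> dM; rewrite derive_fsum; last first.
  by move=> i _; apply: differentiable_entry.
by apply: eq_bigr => i _; rewrite derive_mxE.
Qed.

Lemma differentiable_det n (M : V -> 'M[R]_n) z :
  differentiable M z -> differentiable (fun y => \det (M y)) z.
Proof.
move=> dM; apply: differentiable_fsum => s _.
apply: differentiableM; first exact: differentiable_cst.
by apply: differentiable_fprod => i _; apply: differentiable_entry.
Qed.

(* Jacobi's formula: differentiate the Leibniz expansion one row at a time, then
   expand each resulting determinant along the differentiated row. *)
Lemma derive_det n (M : V -> 'M[R]_n) v z : differentiable M z ->
  'D_v (fun y => \det (M y)) z = \tr (\adj (M z) *m 'D_v M z).
Proof.
move=> dM.
pose Mk k : 'M[R]_n := \matrix_(i, j) if i == k then ('D_v M z) k j else M z i j.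
have -> : 'D_v (fun y => \det (M y)) z = \sum_k \det (Mk k).
  rewrite derive_fsum; last first.
    move=> s _; apply: differentiableM; first exact: differentiable_cst.
    by apply: differentiable_fprod => i _; apply: differentiable_entry.
  rewrite /determinant exchange_big; apply: eq_bigr => s _ /=.
  rewrite derive_fMl; last first.
    by apply: differentiable_fprod => i _; apply: differentiable_entry.
  rewrite derive_fprod; last by move=> i; apply: differentiable_entry.
  rewrite big_distrr /=; apply: eq_bigr => k _; congr (_ * _).
  rewrite [RHS](bigD1 k) //= mxE eqxx derive_mxE //; congr (_ * _).
  by apply: eq_bigr => i ik; rewrite mxE (negPf ik).
rewrite mxtrace_mulC; apply: eq_bigr => k _.
rewrite (expand_det_row _ k) mxE; apply: eq_bigr => j _.
rewrite !mxE eqxx; congr (_ * _).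
rewrite /cofactor; congr (_ * \det _).
by apply/matrixP => i l; rewrite !mxE eq_sym (negPf (neq_lift _ _)).
Qed.
End MatrixDerivative.

(** Near [z] the first-order expansion of [g] is also one of [f], and uniqueness of the differential
    identifies its linear part. *)
Lemma eq_on_differentiable (R : realType) (V W : normedModType R) (U : set V)
    (f g : V -> W) z : open U -> U z -> (forall y, U y -> f y = g y) ->
  differentiable g z -> differentiable f z.
Proof.
move=> oU Uz fg dg.
have [dgc dgo] := (diff_locallyP z g).1 dg.
have Hf : f \o shift z = cst (f z) + 'd g z +o_ 0 id.
  apply/eqaddoP => e e0; have /eqaddoP/(_ e e0) := dgo.
  have : \forall x \near (0 : V), U (x + z).
    have /(_ U) : (fun x : V => x + z) @ 0 --> 0 + z.
      by apply: cvgD; [exact: cvg_id | exact: cvg_cst].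
    by apply; rewrite add0r; exact: open_nbhs_nbhs.
  apply: filterS2 => x Ux; rewrite !fctE /= !fg //.
apply/diff_locallyP; rewrite (diff_unique dgc Hf); split => //.
Qed.

(** * Symmetry of second derivatives *)

Section Schwarz.
Context (R : realType) (V : normedModType R).
Implicit Types (f : V -> R) (U : set V) (v w x z : V).

(** Restriction to a line gives access to the one-variable mean value theorem. *)
Lemma is_derive_line f x v (s : R) : differentiable f (x + s *: v) ->
  is_derive s 1 (fun s : R => f (x + s *: v)) ('D_v f (x + s *: v)).
Proof.
move=> df.
have dl : is_diff s (fun s : R => x + s *: v) (fun s : R => s *: v).
  apply: is_diff_eq.
  by apply/funext => y; rewrite add0r.
have dfl : differentiable (fun s : R => f (x + s *: v)) s.
  exact: (@differentiable_comp _ _ _ _ (fun s : R => x + s *: v) f).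
apply: DeriveDef; first exact: diff_derivable.
rewrite (@derive_fcomp _ _ _ _ (fun s : R => x + s *: v) f) //.
suff -> : 'D_1 (fun s : R => x + s *: v) s = v by [].
by rewrite deriveE // diff_val scale1r.
Qed.

(* The mean value theorem, applied first along [v] and then along [w], turns the
   second difference into [h ^+ 2] times a nearby value of the mixed derivative. *)
Lemma second_difference_cvg f U v w z e : open U -> U z ->
  (forall x, U x -> differentiable f x) ->
  (forall x, U x -> differentiable ('D_v f) x) ->
  {for z, continuous ('D_w ('D_v f))} -> 0 < e ->
  exists2 del, 0 < del & forall h, 0 < h -> h < del ->
    `|(f (z + h *: v + h *: w) - f (z + h *: v) - f (z + h *: w) + f z)
       - h ^+ 2 * 'D_w ('D_v f) z| <= e * h ^+ 2.
Proof.
move=> oU Uz df dDf cD e0.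
have [r /= r0 Hr] : exists2 r : R, 0 < r & forall x, `|x - z| < r ->
    U x /\ `|'D_w ('D_v f) x - 'D_w ('D_v f) z| < e.
  have H1 : \forall x \near z, U x by exact: open_nbhs_nbhs.
  have H2 : \forall x \near z, `|'D_w ('D_v f) x - 'D_w ('D_v f) z| < e.
    move/cvgrPdist_lt : cD => /(_ e e0); apply: filterS => x Hx.
    rewrite distrC; exact: Hx.
  have /(_ _)/nbhs_normP := @filterI _ _ _ _ _ H1 H2.
  move=> [r /= r0 Hr].
  by exists r => // x xz; apply: Hr; rewrite /= distrC.
(* The added 1 keeps [N] positive when [v] and [w] both vanish; for [h < r / N] all points used
   below stay within [r] of [z]. *)
pose N := `|v| + `|w| + 1.
have N0 : 0 < N by rewrite /N; have := normr_ge0 v; have := normr_ge0 w; lra.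
exists (r / N); first by rewrite divr_gt0.
move=> h h0 hr.
have near_z s t : s \in `[0, h] -> t \in `[0, h] ->
    U (z + s *: v + t *: w) /\
    `|'D_w ('D_v f) (z + s *: v + t *: w) - 'D_w ('D_v f) z| < e.
  rewrite !in_itv /= => /andP[s0 sh] /andP[t0 th]; apply: Hr.
  have -> : z + s *: v + t *: w - z = s *: v + t *: w.
    by rewrite -[z + _ + _]addrA addrAC subrr add0r.
  apply: le_lt_trans (ler_normD _ _) _; rewrite !normrZ !ger0_norm //.
  have : h * N < r by rewrite -ltr_pdivlMr.
  apply: le_lt_trans; rewrite /N !mulrDr mulr1.
  have := ler_wpM2r (normr_ge0 v) sh; have := ler_wpM2r (normr_ge0 w) th.
  by lra.
have h_in : h \in `[0, h] by rewrite in_itv /= ltW //= lexx.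
have o_in : 0 \in `[0, h] by rewrite in_itv /= lexx ltW.
have in_oc s : s \in `]0, h[ -> s \in `[0, h].
  by rewrite !in_itv /= => /andP[/ltW-> /ltW->].
(* The second difference is [g h - g 0]: [g] is the increment of [f] over [h *: w], as a function of
   the displacement along [v]. *)
pose g (s : R) := f (z + h *: w + s *: v) - f (z + s *: v).
pose dg (s : R) := 'D_v f (z + h *: w + s *: v) - 'D_v f (z + s *: v).
have dgP s : s \in `[0, h] -> is_derive s 1 g (dg s).
  move=> sh.
  have U1 : U (z + h *: w + s *: v).
    by rewrite addrAC; have [] := near_z s h sh h_in.
  have U2 : U (z + s *: v).
    by have [] := near_z s 0 sh o_in; rewrite scale0r addr0.
  exact: is_deriveB (is_derive_line (df _ U1)) (is_derive_line (df _ U2)).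
have gc : {within `[0, h], continuous g}.
  apply: derivable_within_continuous => x xh.
  by have [] := dgP _ xh.
have [c ch gE] := MVT h0 (fun s sh => dgP s (in_oc s sh)) gc.
have {}ch := in_oc _ ch.
pose k (t : R) := 'D_v f (z + c *: v + t *: w).
pose dk (t : R) := 'D_w ('D_v f) (z + c *: v + t *: w).
have dkP t : t \in `[0, h] -> is_derive t 1 k (dk t).
  move=> th; apply: is_derive_line; apply: dDf.
  by have [] := near_z c t ch th.
have kc : {within `[0, h], continuous k}.
  apply: derivable_within_continuous => x xh.
  by have [] := dkP _ xh.
have [c' ch' kE] := MVT h0 (fun s sh => dkP s (in_oc s sh)) kc.
have {}ch' := in_oc _ ch'.
have dgk : dg c = k h - k 0.
  by rewrite /dg /k scale0r addr0 addrAC.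
have -> : f (z + h *: v + h *: w) - f (z + h *: v) - f (z + h *: w) + f z
    = h ^+ 2 * dk c'.
  transitivity (g h - g 0); last by rewrite gE dgk kE !subr0; ring.
  by rewrite /g !scale0r !addr0 [z + h *: w + h *: v]addrAC; ring.
rewrite -mulrBr normrM ger0_norm ?sqr_ge0 // mulrC ler_wpM2r ?sqr_ge0 //.
by apply/ltW; have [] := near_z c c' ch ch'.
Qed.

(* The second difference is symmetric in [v] and [w]. *)
Lemma derive_comm f U v w z : open U -> U z ->
  (forall x, U x -> differentiable f x) ->
  (forall x, U x -> differentiable ('D_v f) x) ->
  (forall x, U x -> differentiable ('D_w f) x) ->
  {for z, continuous ('D_w ('D_v f))} -> {for z, continuous ('D_v ('D_w f))} ->
  'D_w ('D_v f) z = 'D_v ('D_w f) z.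
Proof.
move=> oU Uz df dv dw cvw cwv; apply/eqP; rewrite -subr_eq0 -normr_le0.
apply/ler_addgt0Pl => e e0; rewrite addr0.
(* Two estimates with error [e / 4] bound the gap between the mixed derivatives by [e / 2]. *)
have e40 : 0 < e / 4 by rewrite divr_gt0.
have [d1 d10 H1] := second_difference_cvg oU Uz df dv cvw e40.
have [d2 d20 H2] := second_difference_cvg oU Uz df dw cwv e40.
pose h := Num.min d1 d2 / 2.
have m0 : 0 < Num.min d1 d2 by rewrite lt_min d10.
have h0 : 0 < h by rewrite divr_gt0.
have hm : h < Num.min d1 d2 by rewrite /h; lra.
have /andP[hd1 hd2] : (h < d1) && (h < d2) by rewrite -lt_min.
have {}H1 := H1 h h0 hd1; have {}H2 := H2 h h0 hd2.
have h20 : 0 < h ^+ 2 by rewrite exprn_gt0.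
rewrite -(ler_pM2r h20) -[h ^+ 2 in leLHS]ger0_norm ?ltW // -normrM.
move: H1 H2; rewrite [z + h *: w + h *: v]addrAC.
move: ('D_w _ z) ('D_v _ z) (f (z + h *: v + h *: w)) (f (z + h *: v))
  (f (z + h *: w)) (f z) (h ^+ 2) h20.
move=> x y a b c d k k0; rewrite !ler_norml => /andP[H1 H1'] /andP[H2 H2'].
have ek : 0 < e * k by exact: mulr_gt0.
by rewrite ltr_norml; apply/andP; split; lra.
Qed.

End Schwarz.

(** * Positive definite matrices *)

Section PositiveDefinite.
Context (R : realType) (d : nat).
Implicit Types (M C G A : 'M[R]_d).

Lemma spd_congr M G : spd M -> G \in unitmx -> spd (G *m M *m G^T).
Proof.
move=> [Ms Mp] Gu; split; first by rewrite !trmx_mul trmxK Ms mulmxA.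
move=> v v0; have {}v0 : G^T *m v != 0.
  apply: contraNneq v0 => /(congr1 (mulmx (invmx G^T))).
  by rewrite mulKmx ?unitmx_tr // mulmx0 => ->.
by have := Mp _ v0; rewrite trmx_mul trmxK !mulmxA.
Qed.

(* Along the segment from the identity to [M] the matrix stays positive definite,
   hence invertible, so its determinant keeps its sign. *)
Lemma spd_det_gt0 M : spd M -> 0 < \det M.
Proof.
move=> [Ms Mp]; rewrite ltNge; apply/negP => M0.
(* [P] is minus the determinant along the segment, as a polynomial. With this sign it is -1 at 0
   and, under the negated claim, nonnegative at 1, as the intermediate value theorem requires. *)
pose P : {poly R} := - \det (\matrix_(i, j) ((1 - 'X) * (i == j)%:R + 'X * (M i j)%:P)).
have PE s : P.[s] = - \det ((1 - s) *: 1%:M + s *: M).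
  rewrite hornerN -horner_evalE -det_map_mx; congr (- \det _).
  apply/matrixP => i j; rewrite !mxE /= horner_evalE !hornerE.
  by case: (i == j); rewrite /= ?hornerE.
have [||s /andP[s0 s1]] := @poly_ivt _ P 0 1 => //.
  rewrite !PE subr0 scale0r addr0 scale1r det1 subrr scale0r add0r scale1r.
  by rewrite oppr_ge0 M0 oppr_le0 ler01.
rewrite /root PE oppr_eq0 => /det0P[v v0 vQ].
have vT0 : v^T != 0 by rewrite trmx_eq0.
have : (v *m ((1 - s) *: 1%:M + s *: M) *m v^T) 0 0 = 0 by rewrite vQ mul0mx mxE.
rewrite mulmxDr -!scalemxAr mulmx1 mulmxDl -!scalemxAl mxE.
rewrite [X in X + _]mxE [X in _ + X]mxE.
have Mv := Mp _ vT0; rewrite trmxK in Mv.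
have vv : 0 < (v *m v^T) 0 0.
  rewrite mxE; under eq_bigr do rewrite mxE -expr2.
  rewrite lt_def sumr_ge0 ?andbT; last by move=> i _; exact: sqr_ge0.
  apply: contraNneq v0 => /eqP; rewrite psumr_eq0; last by move=> i _; exact: sqr_ge0.
  move=> /allP vi; apply/eqP/rowP => i; rewrite mxE.
  by have := vi i (mem_index_enum _); rewrite /= sqrf_eq0 => /eqP.
apply/eqP; rewrite gt_eqF //.
(* At [s = 0] only the identity term survives; for [s > 0] the [M] term is strictly positive and the
   other one nonnegative. *)
move: s0; rewrite le_eqVlt => /orP[/eqP <-|s0].
  by rewrite subr0 mul1r mul0r addr0.
by rewrite ltr_wpDl // ?mulr_gt0 // mulr_ge0 ?subr_ge0 // ltW.
Qed.

Lemma spd_unitmx M : spd M -> M \in unitmx.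
Proof. by move=> /spd_det_gt0 M0; rewrite unitmxE unitfE gt_eqF. Qed.

(** The inverse is the congruence of [M] by [invmx M]. *)
Lemma spd_invmx M : spd M -> spd (invmx M).
Proof.
move=> Mp; have Mu := spd_unitmx Mp.
have -> : invmx M = invmx M *m M *m (invmx M)^T.
  by rewrite mulVmx // mul1mx trmx_inv Mp.1.
by apply: spd_congr; rewrite ?unitmx_inv.
Qed.

(** Each diagonal entry is the quadratic form of [M] at a row of [G]. As [G] may be singular, a zero
    row is treated apart. *)
Lemma spd_trace_ge0 M G : spd M -> 0 <= \tr (G *m M *m G^T).
Proof.
move=> [_ Mp]; apply: sumr_ge0 => i _.
have -> : (G *m M *m G^T) i i = (((row i G)^T)^T *m M *m (row i G)^T) 0 0.
  rewrite trmxK -row_mul !mxE; apply: eq_bigr => k _; rewrite !mxE.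
  by congr (_ * _); apply: eq_bigr => l _; rewrite !mxE.
have [->|r0] := eqVneq (row i G) 0.
  by rewrite trmx0 mulmx0 mxE.
by apply/ltW/Mp; rewrite trmx_eq0.
Qed.

End PositiveDefinite.

(** * Free energy, stress and dissipation *)

Section Thermodynamics.
Context (R : realType) (d : nat).
Implicit Types (m : maxwell_constants R) (r : R).
Implicit Types (M C G A : 'M[R]_d).

(** The index pattern of the triple sum is a congruence of [invmx C] by [S], from which the sign can
    be read. *)
Lemma dissipationE m C :
  let S := (K m * Hp m) *: C - (kB m * theta m) *: 1%:M in
  dissipation m C = \tr (S *m invmx C *m S^T).
Proof.
move=> S; rewrite /dissipation -/S; apply: eq_bigr => i _.
rewrite !mxE exchange_big; apply: eq_bigr => k _ /=.
by rewrite !mxE big_distrl.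
Qed.

Lemma dissipation_ge0 m C : spd C -> 0 <= dissipation m C.
Proof. by move=> Cp; rewrite dissipationE; apply/spd_trace_ge0/spd_invmx. Qed.

Lemma sum_strain_trace G A :
  \sum_i \sum_al \sum_be G i al * G i be * A al be = \tr (G *m A *m G^T).
Proof.
apply: eq_bigr => i _; rewrite mxE exchange_big; apply: eq_bigr => be _ /=.
by rewrite !mxE big_distrl; apply: eq_bigr => al _ /=; rewrite mulrAC.
Qed.

Lemma free_energyE m (e0 : R -> R) r G A : free_energy m e0 r G A
  = e0 r + K m * Hp m * \tr (G *m A *m G^T)
    - kB m * theta m * ln (\det (G *m A *m G^T)).
Proof. by rewrite /free_energy sum_strain_trace. Qed.

(** The determinant of [G A G^T] is [det G ^ 2 * det A], and [1 / det G] is the density ratio; hence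
    the factor 2 and the sign of its logarithm. *)
Lemma free_energy_density m (e0 : R -> R) rhohat G A :
    0 < rhohat -> 0 < \det G -> 0 < \det A ->
  free_energy m e0 (rhohat / \det G) G A
  = free_energy_of_density m e0 rhohat (rhohat / \det G) G A.
Proof.
move=> r0 G0 A0; rewrite /free_energy /free_energy_of_density -!addrA.
congr (_ + (_ + _)).
have -> : rhohat / \det G / rhohat = (\det G)^-1.
  by rewrite mulrAC mulfV ?gt_eqF // mul1r.
rewrite !det_mulmx det_tr.
by rewrite !lnM ?posrE ?mulr_gt0 // lnV ?posrE //; ring.
Qed.

Lemma free_energy_strain m (e0 : R -> R) r G A :
  free_energy m e0 r G A = free_energy_of_strain m e0 r A (G^T *m G).
Proof.
rewrite /free_energy /free_energy_of_strain; congr (_ + _ * _ - _ * ln _).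
  rewrite exchange_big; apply: eq_bigr => al _.
  rewrite exchange_big; apply: eq_bigr => be _.
  by rewrite mxE big_distrl; apply: eq_bigr => i _; rewrite mxE.
by rewrite !det_mulmx det_tr; ring.
Qed.

(** The derivative of [v -> 1 / v] at [v = 1 / r] is [- r ^ 2], whose sign cancels the one in the
    definition. *)
Lemma pressureE (e0 : R -> R) r : (forall s : R, 0 < s -> differentiable e0 s) -> 0 < r ->
  pressure e0 r = r ^+ 2 * 'D_1 e0 r.
Proof.
move=> de r0; rewrite /pressure derive1E.
have ri0 : r^-1 != 0 by rewrite gt_eqF // invr_gt0.
rewrite (@derive_fcomp _ _ _ _ (GRing.inv : R -> R) e0) //; last 2 first.
- exact: differentiable_Rinv.
- by rewrite invrK; apply: de.
have -> : 'D_1 (GRing.inv : R -> R) r^-1 = (- r ^+ 2) *: 1.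
  rewrite deriveE; last exact: differentiable_Rinv.
  by rewrite (diff_Rinv ri0) exprVn invrK.
rewrite invrK derive_dirZ; last exact: de.
by rewrite scaleNr opprK.
Qed.

(** The pressure is itself a derivative, so its regularity comes from the second derivative of [e0];
    the divergence of the stress requires it. *)
Lemma differentiable_pressure (e0 : R -> R) r : (forall s : R, 0 < s -> differentiable e0 s) ->
  (forall s : R, 0 < s -> differentiable ('D_1 e0) s) -> 0 < r ->
  differentiable (pressure e0) r.
Proof.
move=> de dde r0.
apply: (@eq_on_differentiable _ _ _ [set s : R | 0 < s] _ (fun s => s ^+ 2 * 'D_1 e0 s)) => //.
- by move=> s s0; exact: pressureE.
- apply: differentiableM; last exact: dde.
  exact: (@differentiableX _ _ id 1).
Qed.

Lemma differentiable_ln (r : R) : 0 < r -> differentiable (@ln R) r.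
Proof. by move=> r0; apply/derivable1_diffP; have [] := is_derive1_ln r0. Qed.

Lemma derive_fln (V : normedModType R) (g : V -> R) v z : 0 < g z ->
  differentiable g z -> 'D_v (fun y => ln (g y)) z = 'D_v g z / g z.
Proof.
move=> g0 dg; rewrite (@derive_fcomp _ _ _ _ g (@ln R)) //; last exact: differentiable_ln.
rewrite -['D_v g z]mulr1 derive_dirZ; last exact: differentiable_ln.
by have [_ ->] := is_derive1_ln g0; rewrite mulr1.
Qed.

Lemma adjE M : M \in unitmx -> \adj M = \det M *: invmx M.
Proof. by move=> Mu; rewrite /invmx Mu scalerA mulfV ?scale1r // -unitfE. Qed.

(** Logarithmic form of Jacobi's formula: the determinant contained in the adjugate cancels the one
    in the denominator. *)
Lemma derive_lndet (V : normedModType R) (M : V -> 'M[R]_d) v z : 0 < \det (M z) ->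
  differentiable M z -> 'D_v (fun y => ln (\det (M y))) z = \tr (invmx (M z) *m 'D_v M z).
Proof.
move=> M0 dM; have Mu : M z \in unitmx by rewrite unitmxE unitfE gt_eqF.
rewrite derive_fln ?derive_det //; last exact: differentiable_det.
rewrite adjE // -scalemxAl mxtraceZ mulrC mulKf // gt_eqF //.
Qed.

(** The strain derivative of the energy is [K H' A - kB theta C^-T]. Pushed forward by [G], [A]
    becomes [G A G^T], and [C^-T] becomes the identity since [C = G^T G]. *)
Lemma stress_hyperelastic m (e0 : R -> R) r G A : 0 < \det G -> 0 < \det A ->
  stress m e0 r (G *m A *m G^T) = hyperelastic_stress m e0 r G A.
Proof.
move=> G0 A0; have Gu : G \in unitmx by rewrite unitmxE unitfE gt_eqF.
have C0 : 0 < \det (G^T *m G) by rewrite det_mulmx det_tr mulr_gt0.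
have DE al be : 'D_(delta_mx al be : 'M[R]_d)
      (free_energy_of_strain m e0 r A : 'M[R]_d -> R) (G^T *m G)
    = K m * Hp m * A al be - kB m * theta m * invmx (G^T *m G) be al.
  have did : differentiable (fun C : 'M[R]_d => C) (G^T *m G) by [].
  have dent al' be' : differentiable (fun C : 'M[R]_d => C al' be' * A al' be') (G^T *m G).
    apply: differentiableM; last exact: differentiable_cst.
    exact: differentiable_coord.
  have ds : differentiable
      (fun C : 'M[R]_d => \sum_al' \sum_be' C al' be' * A al' be') (G^T *m G).
    by do 2!(apply: differentiable_fsum => ? _).
  have dd : differentiable (fun C : 'M[R]_d => ln (\det C)) (G^T *m G).
    apply: (@differentiable_comp _ _ _ _ (fun C : 'M[R]_d => \det C) (@ln R)).
      exact: differentiable_det.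
    exact: differentiable_ln.
  (* The logarithm of the product splits where [det C] is positive, which is an open condition;
     [ln (\det A)] is then a constant. *)
  rewrite (@eq_on_derive _ _ _ [set C : 'M[R]_d | 0 < \det C] _
    (fun C : 'M[R]_d => e0 r
      + K m * Hp m * (\sum_al' \sum_be' C al' be' * A al' be')
      - kB m * theta m * (ln (\det C) + ln (\det A)))) //; first last.
  - by move=> C /= Cp; rewrite /free_energy_of_strain lnM ?posrE.
  - apply: (@open_comp _ _ (fun C : 'M[R]_d => \det C) [set x : R | 0 < x]);
      last exact: open_gt.
    by move=> C _; apply: differentiable_continuous; apply: differentiable_det.
  have dc (a : R) : differentiable (fun=> a : R) (G^T *m G) by exact: differentiable_cst.
  rewrite derive_fB ?derive_fD ?derive_fMl ?derive_fD ?derive_cst //; first last.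
  all: try by repeat first [apply: differentiableD | apply: differentiableM].
  rewrite add0r addr0 derive_lndet // derive_id derive_fsum; last first.
    by move=> ? _; apply: differentiable_fsum.
  congr (_ * _ - _ * _).
    rewrite (bigD1 al) //= [X in _ + X]big1 ?addr0; last first.
      move=> i ial; rewrite derive_fsum // big1 // => j _.
      rewrite derive_fM ?derive_cst ?mulr0 ?addr0 //; last exact: differentiable_coord.
      rewrite -derive_mxE // derive_id mxE (negPf ial) /= mul0r //.
    rewrite derive_fsum // (bigD1 be) //= [X in _ + X]big1 ?addr0; last first.
      move=> j jbe.
      rewrite derive_fM ?derive_cst ?mulr0 ?addr0 //; last exact: differentiable_coord.
      rewrite -derive_mxE // derive_id mxE (negPf jbe) andbF /= mul0r //.
    rewrite derive_fM ?derive_cst ?mulr0 ?addr0 //; last exact: differentiable_coord.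
    by rewrite -derive_mxE // derive_id mxE !eqxx /= mul1r.
  rewrite mxtrace_mulC /mxtrace (bigD1 al) //= [X in _ + X]big1 ?addr0.
    rewrite mxE (bigD1 be) //= [X in _ + X]big1 ?addr0.
      by rewrite mxE !eqxx mul1r.
    by move=> j jbe; rewrite mxE (negPf jbe) andbF mul0r.
  by move=> i ial; rewrite mxE big1 // => j _; rewrite mxE (negPf ial) mul0r.
apply/matrixP => i j; rewrite !mxE; congr (_ + _ * _).
under [RHS]eq_bigr => al _ do under eq_bigr => be _ do rewrite DE.
(* Jacobi's formula delivers entry [be al] of the inverse, hence the transpose. *)
transitivity ((G *m ((K m * Hp m) *: A
  - (kB m * theta m) *: (invmx (G^T *m G))^T) *m G^T) i j); last first.
  rewrite !mxE exchange_big; apply: eq_bigr => be _.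
  rewrite !mxE big_distrl; apply: eq_bigr => al _; rewrite !mxE /=; ring.
have GG : G *m (invmx (G^T *m G))^T *m G^T = 1%:M.
  apply: mulmx1C; rewrite mulmxA trmx_inv trmx_mul trmxK mulmxV //.
  by rewrite unitmx_mul unitmx_tr Gu.
by rewrite mulmxBr mulmxBl -!scalemxAr -!scalemxAl GG !mxE.
Qed.

End Thermodynamics.

(** * Kinematics of a smooth motion *)

Section ProductSpace.
Context (R : realType) (U V : normedModType R).

Fact fst_is_linear : linear (@fst U V). Proof. by []. Qed.
HB.instance Definition _ :=
  GRing.isLinear.Build R (U * V)%type U *:%R (@fst U V) fst_is_linear.

Lemma continuous_fst : continuous (@fst U V).
Proof. by move=> z; exact: cvg_fst. Qed.

Lemma differentiable_fst (z : U * V) : differentiable (@fst U V) z.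
Proof. exact/linear_differentiable/continuous_fst. Qed.

Lemma derive_fst (v z : U * V) : 'D_v (@fst U V) z = v.1.
Proof.
rewrite deriveE; last exact: differentiable_fst.
by rewrite diff_lin //; exact: continuous_fst.
Qed.

Lemma derive_pair (X : normedModType R) (f : X -> U) (g : X -> V) v z :
  differentiable f z -> differentiable g z ->
  'D_v (fun y => (f y, g y)) z = ('D_v f z, 'D_v g z).
Proof.
move=> df dg; rewrite deriveE; last exact: differentiable_pair.
by rewrite diff_pair // !deriveE.
Qed.

Lemma openX (A : set U) (B : set V) : open A -> open B -> open (A `*` B).
Proof.
move=> oA oB.
have -> : A `*` B = (@fst U V) @^-1` A `&` (@snd U V) @^-1` B by [].
apply: openI; apply: open_comp => // z _; [exact: cvg_fst | exact: cvg_snd].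
Qed.

End ProductSpace.

(** * Smooth functions on an open set *)

Section SmoothOn.
Context (R : realType) (V : normedModType R).
Implicit Types (U : set V) (f : V -> R).

Lemma smooth_on_differentiable U f z : smooth_on U f -> U z -> differentiable f z.
Proof. by move=> /(_ 1%N)[+ _]; apply. Qed.

Lemma smooth_on_derive U f v : smooth_on U f -> smooth_on U ('D_v f).
Proof. by move=> sf k; have [_] := sf k.+1; apply. Qed.

Lemma smooth_on_continuous U f z : smooth_on U f -> U z -> {for z, continuous f}.
Proof. by move=> /(_ 0%N) /= + Uz; apply. Qed.

Lemma smooth_on_derive_comm U f v w z : open U -> smooth_on U f -> U z ->
  'D_w ('D_v f) z = 'D_v ('D_w f) z.
Proof.
move=> oU sf Uz; apply: (@derive_comm _ _ _ U) => //.
- by move=> x; exact: smooth_on_differentiable.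
- by move=> x; apply/smooth_on_differentiable/smooth_on_derive.
- by move=> x; apply/smooth_on_differentiable/smooth_on_derive.
- by apply: smooth_on_continuous Uz; do 2!apply: smooth_on_derive.
- by apply: smooth_on_continuous Uz; do 2!apply: smooth_on_derive.
Qed.

End SmoothOn.

Definition velocity_gradient (R : realType) (d : nat)
    (u : spacetime R d -> 'rV[R]_d) (z : spacetime R d) : 'M[R]_d :=
  \matrix_(i, j) dx j (fun y => u y 0 i) z.

Section Kinematics.
Context (R : realType) (d : nat) (J : set R) (B : set 'rV[R]_d).
Context (phi phinv : spacetime R d -> 'rV[R]_d).
Hypothesis motion : smooth_motion J B phi phinv.

Let Om := occupied J B phi.
(** [Phi] and [Psi] keep the time coordinate, so that a material derivative is the derivative along
    [(1, 0)] of a composite with [Phi]. *)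
Let Phi (y : spacetime R d) : spacetime R d := (y.1, phi y).
Let Psi (z : spacetime R d) : spacetime R d := (z.1, phinv z).
Let u := velocity phi phinv.
Let F := deformation_gradient phi phinv.

Lemma open_material : open (J `*` B).
Proof. by apply: openX; [exact: motion_times_open motion|exact: motion_body_open motion]. Qed.

Lemma material_placement y : (J `*` B) y -> Psi (Phi y) = y.
Proof.
by case: y => t a [/= Jt Ba]; rewrite /Psi /Phi /= (motion_inverse motion).
Qed.

(** The hypothesis makes [phinv] a left inverse; writing each occupied point as a placement makes
    this usable from the spatial side. *)
Lemma placement_material z : Om z -> exists2 y, (J `*` B) y & z = Phi y.
Proof.
by case: z => t x [/= Jt [a Ba phix]]; exists (t, a) => //; rewrite /Phi /= phix.
Qed.

Lemma material_label z : Om z -> (J `*` B) (Psi z).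
Proof. by move=> /placement_material[y By ->]; rewrite material_placement. Qed.

Lemma differentiable_motion y : (J `*` B) y -> differentiable phi y.
Proof.
move=> By; apply: differentiable_mx => i j; rewrite (ord1 i).
exact: smooth_on_differentiable (motion_smooth motion j) By.
Qed.

Lemma differentiable_placement y : (J `*` B) y -> differentiable Phi y.
Proof.
move=> By; apply: differentiable_pair; first exact: differentiable_fst.
exact: differentiable_motion.
Qed.

Lemma differentiable_label z : Om z -> differentiable Psi z.
Proof.
move=> Oz; apply: differentiable_pair; first exact: differentiable_fst.
apply: differentiable_mx => i j; rewrite (ord1 i).
exact: smooth_on_differentiable (motion_inverse_smooth motion j) Oz.
Qed.

(** [v = (1, 0)] gives the velocity components, [v = (0, delta_mx 0 al)] the entries of [F]. *)
Lemma differentiable_motion_gradient v i z : Om z ->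
  differentiable (fun y => 'D_v (fun y' => phi y' 0 i) (Psi y)) z.
Proof.
move=> Oz; apply: (@differentiable_comp _ _ _ _ Psi ('D_v (fun y' => phi y' 0 i))).
  exact: differentiable_label.
apply: smooth_on_differentiable (material_label Oz).
exact: smooth_on_derive (motion_smooth motion i).
Qed.

Lemma differentiable_velocity z : Om z -> differentiable u z.
Proof.
move=> Oz; apply: differentiable_mx => i j.
under eq_fun do rewrite mxE.
exact: differentiable_motion_gradient.
Qed.

Lemma differentiable_deformation_gradient z : Om z -> differentiable F z.
Proof.
move=> Oz; apply: differentiable_mx => i j.
under eq_fun do rewrite mxE.
exact: differentiable_motion_gradient.
Qed.

Lemma deformation_gradient_det_gt0 z : Om z -> 0 < \det (F z).
Proof.
move=> Oz; rewrite /F /deformation_gradient.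
have [/= Jt Ba] := material_label Oz.
exact: (motion_jacobian_gt0 motion).
Qed.

Lemma deformation_gradient_unit z : Om z -> F z \in unitmx.
Proof.
by move=> Oz; rewrite unitmxE unitfE gt_eqF // deformation_gradient_det_gt0.
Qed.

Lemma derive_placement v y : (J `*` B) y -> 'D_v Phi y = (v.1, 'D_v phi y).
Proof.
move=> By; rewrite derive_pair ?derive_fst //; first exact: differentiable_fst.
exact: differentiable_motion.
Qed.

(** Chain rule through the placement: [(v.1, 'D_v phi y)] is the push-forward of [v], namely
    [(1, u)] for the time direction and [(0, F e_al)] for a material one. *)
Lemma derive_placement_comp v (g : spacetime R d -> R) h y : (J `*` B) y ->
  differentiable g (Phi y) -> (forall y', (J `*` B) y' -> g (Phi y') = h y') ->
  'D_(v.1, 'D_v phi y) g (Phi y) = 'D_v h y.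
Proof.
move=> By dg gh; rewrite -derive_placement // -derive_fcomp //; last first.
  exact: differentiable_placement.
by apply: eq_on_derive gh => //; exact: open_material.
Qed.

(* Both sides are the mixed derivative of the motion in time and label, read at
   the label of [z]. *)
Lemma material_derivative_gradient z : Om z ->
  'D_((1, u z) : spacetime R d) F z = velocity_gradient u z *m F z.
Proof.
move=> Oz; have [y By zE] := placement_material Oz.
have Oy : Om (Phi y) by rewrite -zE.
have dF := differentiable_deformation_gradient Oy.
have du := differentiable_velocity Oy.
have dphi := differentiable_motion By.
have uE y' i : (J `*` B) y' -> u (Phi y') 0 i = 'D_(1, 0) (fun y => phi y 0 i) y'.
  by move=> By'; rewrite mxE -/(Psi (Phi y')) material_placement.
have FE y' i al : (J `*` B) y' ->
    F (Phi y') i al = 'D_(0, delta_mx 0 al) (fun y => phi y 0 i) y'.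
  by move=> By'; rewrite mxE -/(Psi (Phi y')) material_placement.
rewrite zE; apply/matrixP => i al.
have -> : u (Phi y) = 'D_(1, 0) phi y.
  by apply/rowP => j; rewrite uE // derive_mxE.
rewrite derive_mxE //.
have := @derive_placement_comp (1, 0) (fun z => F z i al)
  ('D_(0, delta_mx 0 al) (fun y => phi y 0 i)) y By.
move=> /= ->; [|exact: differentiable_entry|by move=> y' By'; rewrite FE].
rewrite (smooth_on_derive_comm _ _ open_material (motion_smooth motion i)) //.
have := @derive_placement_comp (0, delta_mx 0 al) (fun z => u z 0 i)
  ('D_(1, 0) (fun y => phi y 0 i)) y By.
move=> /= <-; [|exact: differentiable_entry|by move=> y' By'; rewrite uE].
rewrite mxE.
(* The pushed-forward label direction is expanded in the spatial basis with column [al] of [F];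
   these coefficients form the matrix product. *)
have -> : ((0, 'D_(0, delta_mx 0 al) phi y) : spacetime R d)
    = \sum_k F (Phi y) k al *: ((0, delta_mx 0 k) : spacetime R d).
  rewrite [RHS](_ : _ = (0, \sum_k F (Phi y) k al *: delta_mx 0 k)).
    congr pair; rewrite [LHS]row_sum_delta; apply: eq_bigr => k _.
    by rewrite FE // derive_mxE.
  elim/big_rec2 : _ => // k b c _ ->.
  by congr pair; rewrite /= scaler0 addr0.
have dui : differentiable (fun z => u z 0 i) (Phi y) by exact: differentiable_entry.
rewrite derive_dir_sum //; apply: eq_bigr => k _.
have -> : velocity_gradient u (Phi y) i k = 'D_(0, delta_mx 0 k) (fun z => u z 0 i) (Phi y).
  by rewrite mxE.
by rewrite derive_dirZ // mulrC.
Qed.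

End Kinematics.

(** * Transport and constitutive identities *)

Section Transport.
Context (R : realType) (d : nat).
Implicit Types (rho g : spacetime R d -> R) (u : spacetime R d -> 'rV[R]_d).

(** Treating [D_t] as one directional derivative along [(1, u z)] makes the product and chain rules
    available to it. *)
Lemma material_derivativeE u g z : differentiable g z ->
  'D_((1, u z) : spacetime R d) g z = dt g z + \sum_k u z 0 k * dx k g z.
Proof.
move=> dg.
have -> : ((1, u z) : spacetime R d)
    = (1, 0) + \sum_k u z 0 k *: ((0, delta_mx 0 k) : spacetime R d).
  have -> : \sum_k u z 0 k *: ((0, delta_mx 0 k) : spacetime R d) = (0, u z).
    rewrite [u z in RHS]row_sum_delta.
    elim/big_rec2 : _ => // k b c _ ->.
    by congr pair; rewrite /= scaler0 addr0.
  by congr pair; rewrite /= ?addr0 ?add0r.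
rewrite derive_dirD // derive_dir_sum //; congr (_ + _).
by apply: eq_bigr => k _; rewrite derive_dirZ.
Qed.

(** The terms in which [g] is not differentiated sum to [g z] times the left side of the mass
    equation. *)
Lemma transport_density rho u g z : differentiable rho z -> differentiable u z ->
    differentiable g z -> dt rho z + \sum_j dx j (fun y => rho y * u y 0 j) z = 0 ->
  dt (fun y => rho y * g y) z + \sum_j dx j (fun y => rho y * u y 0 j * g y) z
  = rho z * 'D_((1, u z) : spacetime R d) g z.
Proof.
move=> drho du dg mass; have dui j := differentiable_entry 0 j du.
rewrite material_derivativeE // {1}/dt derive_fM // -/(dt _ _) -/(dt _ _).
have -> : \sum_j dx j (fun y => rho y * u y 0 j * g y) z
    = (\sum_j dx j (fun y => rho y * u y 0 j) z) * g z
      + rho z * (\sum_j u z 0 j * dx j g z).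
  rewrite big_distrl big_distrr -big_split; apply: eq_bigr => j _ /=.
  by rewrite {1}/dx derive_fM // ?mulrA //; exact: differentiableM.
by rewrite addrACA -mulrDl mass mul0r add0r mulrDr.
Qed.

Lemma mass_material_derivative rho u z : differentiable rho z -> differentiable u z ->
    dt rho z + \sum_j dx j (fun y => rho y * u y 0 j) z = 0 ->
  'D_((1, u z) : spacetime R d) rho z
  = - (rho z * \sum_j dx j (fun y => u y 0 j) z).
Proof.
move=> drho du mass; have dui j := differentiable_entry 0 j du.
apply/eqP; rewrite -addr_eq0; apply/eqP; rewrite -[RHS]mass material_derivativeE // -addrA.
congr (_ + _); rewrite big_distrr -big_split; apply: eq_bigr => j _ /=.
by rewrite [in RHS]/dx derive_fM // mulrC.
Qed.

End Transport.

(** * Differentiability of the inverse matrix *)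

Section InverseMatrix.
Context (R : realType) (V : normedModType R) (d : nat).

Lemma differentiable_adj (M : V -> 'M[R]_d) z : differentiable M z ->
  differentiable (fun y => \adj (M y)) z.
Proof.
move=> dM; apply: differentiable_mx => i j; under eq_fun do rewrite mxE.
apply: differentiableM; first exact: differentiable_cst.
apply: differentiable_det; apply: differentiable_mx => k l.
by under eq_fun do rewrite !mxE; apply: differentiable_entry.
Qed.

(** [invmx] is defined by cases; where the matrix is invertible it is the adjugate over the
    determinant, a rational function of the entries. *)
Lemma differentiable_invmx (U : set V) (M : V -> 'M[R]_d) z : open U -> U z ->
    (forall y, U y -> M y \in unitmx) -> differentiable M z ->
  differentiable (fun y => invmx (M y)) z.
Proof.
move=> oU Uz Mu dM.
have M0 : \det (M z) != 0 by rewrite -unitfE -unitmxE Mu.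
apply: (@eq_on_differentiable _ _ _ U _ (fun y => (\det (M y))^-1 *: \adj (M y))) => //.
  by move=> y /Mu; rewrite /invmx => ->.
apply: differentiable_mx => i j; under eq_fun do rewrite mxE.
apply: differentiableM; first by apply: differentiableV => //; exact: differentiable_det.
by apply: differentiable_entry; exact: differentiable_adj.
Qed.

End InverseMatrix.

(** * Stress power and free energy production *)

Section ConstitutiveLaw.
Context (R : realType) (d : nat).
Implicit Types (m : maxwell_constants R) (r : R) (C L : 'M[R]_d).

Lemma stressE m (e0 : R -> R) r C i j : stress m e0 r C i j
  = - pressure e0 r * (i == j)%:R
    + 2 * r * (K m * Hp m * C i j - kB m * theta m * (i == j)%:R).
Proof. by rewrite !mxE. Qed.

Lemma differentiable_stress (V : normedModType R) m (e0 : R -> R)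
    (rho : V -> R) (C : V -> 'M[R]_d) z i j :
    smooth_on [set r : R | 0 < r] e0 -> 0 < rho z ->
    differentiable rho z -> differentiable C z ->
  differentiable (fun y => stress m e0 (rho y) (C y) i j) z.
Proof.
move=> e0s rho0 drho dC; under eq_fun do rewrite stressE.
have dk (k : R) : differentiable (fun=> k) z by exact: differentiable_cst.
have dCij := differentiable_entry i j dC.
have dp : differentiable (fun y => pressure e0 (rho y)) z.
  apply: (@differentiable_comp _ _ _ _ rho (pressure e0)) => //.
  apply: differentiable_pressure => // s s0.
    exact: smooth_on_differentiable e0s s0.
  by apply: smooth_on_differentiable s0; exact: smooth_on_derive.
apply: differentiableD; apply: differentiableM => //.
- exact: differentiableN.
- exact: differentiableM.
- by apply: differentiableB => //; apply: differentiableM.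
Qed.

(** Put [a = K H'] and [b = kB theta]. Symmetry of [C] and cyclicity of the trace reduce the
    convected terms to [tr (L C)] and [tr L]. The relaxation rate [- 4 / xi (a C - b I)], paired
    with [a I - b C^-1 = (a C - b I) C^-1], gives the dissipation. *)
Lemma free_energy_production m C L (DC : 'M[R]_d) : spd C -> xi m != 0 ->
  DC = L *m C + C *m L^T - (4 * K m * Hp m / xi m) *: C
       + (4 * kB m * theta m / xi m) *: 1%:M ->
  K m * Hp m * \tr DC - kB m * theta m * \tr (invmx C *m DC)
  = 2 * (K m * Hp m * \tr (L *m C) - kB m * theta m * \tr L)
    - 4 / xi m * dissipation m C.
Proof.
move=> Cp xi0 ->; have Cu := spd_unitmx Cp.
have CLt : \tr (C *m L^T) = \tr (L *m C).
  by rewrite -[LHS]mxtrace_tr trmx_mul trmxK Cp.1.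
have CLC : \tr (invmx C *m (L *m C)) = \tr L.
  by rewrite mulmxA mxtrace_mulC mulmxA mulmxV // mul1mx.
have -> : dissipation m C = (K m * Hp m) ^+ 2 * \tr C
    - 2 * (K m * Hp m) * (kB m * theta m) * d%:R
    + (kB m * theta m) ^+ 2 * \tr (invmx C).
  rewrite dissipationE /=.
  set a := K m * Hp m; set b := kB m * theta m.
  have -> : (a *: C - b *: 1%:M)^T = a *: C - b *: 1%:M.
    by rewrite linearB !linearZ /= Cp.1 trmx1.
  have -> : (a *: C - b *: 1%:M) *m invmx C *m (a *: C - b *: 1%:M)
      = a ^+ 2 *: C - (2 * a * b) *: 1%:M + b ^+ 2 *: invmx C.
    rewrite mulmxBl -!scalemxAl mulmxV // mul1mx mulmxBl -!scalemxAl mul1mx.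
    rewrite mulmxBr -!scalemxAr mulVmx // mulmx1.
    apply/matrixP => i j; rewrite !mxE; ring.
  by rewrite mxtraceD raddfB /= !mxtraceZ mxtrace1.
rewrite !(mulmxDr, mulmxBr, mulmxN) -!scalemxAr mulVmx // mulmx1 mulKmx //.
rewrite !(mxtraceD, raddfN) /= !mxtraceZ CLC CLt mxtrace_tr mxtrace1.
by field.
Qed.

(** Symmetry of [C] turns its entrywise pairing with [L] into [tr (L C)]; the isotropic terms see
    only [tr L]. *)
Lemma stress_power m (e0 : R -> R) r C L : C^T = C ->
  \sum_j \sum_i L i j * stress m e0 r C i j
  = - pressure e0 r * \tr L
    + 2 * r * (K m * Hp m * \tr (L *m C) - kB m * theta m * \tr L).
Proof.
move=> Cs.
have S1 : \sum_j \sum_i L i j * (i == j)%:R = \tr L.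
  apply: eq_bigr => j _; rewrite (bigD1 j) //= eqxx mulr1 big1 ?addr0 // => i ij.
  by rewrite (negPf ij) mulr0.
have S2 : \sum_j \sum_i L i j * C i j = \tr (L *m C).
  rewrite exchange_big; apply: eq_bigr => i _; rewrite mxE; apply: eq_bigr => j _ /=.
  by rewrite -{1}Cs mxE.
rewrite -S1 -S2 !mulr_sumr -!sumrB mulr_sumr -big_split; apply: eq_bigr => j _ /=.
rewrite !mulr_sumr -!sumrB mulr_sumr -big_split; apply: eq_bigr => i _ /=.
by rewrite stressE; ring.
Qed.

End ConstitutiveLaw.

(** * The Maxwell model *)

Section MaxwellModel.
Context (R : realType) (d : nat) (m : maxwell_constants R) (e0 : R -> R).
Context (Om : set (spacetime R d)) (u f : spacetime R d -> 'rV[R]_d).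
Context (F c : spacetime R d -> 'M[R]_d) (rho : spacetime R d -> R).

Hypothesis xi_neq0 : xi m != 0.
Hypothesis e0_smooth : smooth_on [set r : R | 0 < r] e0.
Hypothesis Om_open : open Om.
Hypothesis rho_gt0 : forall z, Om z -> 0 < rho z.
Hypothesis F_unit : forall z, Om z -> F z \in unitmx.
Hypothesis c_spd : forall z, Om z -> spd (c z).
Hypothesis drho : forall z, Om z -> differentiable rho z.
Hypothesis du : forall z, Om z -> differentiable u z.
Hypothesis dF : forall z, Om z -> differentiable F z.
Hypothesis dc : forall z, Om z -> differentiable c z.
(** The motion itself is absent from this section: its kinematics enters through this identity. *)
Hypothesis F_transported : forall z, Om z ->
  'D_((1, u z) : spacetime R d) F z = velocity_gradient u z *m F z.

Let A := pulled_back_conformation F c.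
Let mass z := dt rho z + \sum_j dx j (fun y => rho y * u y 0 j) z = 0.

Lemma pulled_back_conformationK z : Om z -> F z *m A z *m (F z)^T = c z.
Proof.
move=> Oz; have Fu := F_unit Oz.
rewrite /A /pulled_back_conformation trmx_inv !mulmxA mulmxV // mul1mx.
by rewrite mulmxKV // unitmx_tr.
Qed.

Lemma differentiable_pulled_back_conformation z : Om z -> differentiable A z.
Proof.
move=> Oz.
have dFi : differentiable (fun y => invmx (F y)) z.
  by apply: (differentiable_invmx Om_open) => //; exact: dF.
apply: differentiable_mulmx; last exact: differentiable_trmx.
by apply: differentiable_mulmx => //; exact: dc.
Qed.

(** The value of [D_t c] obtained by solving the upper-convected equation for it. *)
Definition ucm_conformation_rate z : 'M[R]_d :=
  velocity_gradient u z *m c z + c z *m (velocity_gradient u z)^T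
  - (4 * K m * Hp m / xi m) *: c z + (4 * kB m * theta m / xi m) *: 1%:M.

Lemma ucm_conformationP z : Om z ->
  (forall i j : 'I_d,
      dt (fun y => c y i j) z
      + \sum_k u z 0 k * dx k (fun y => c y i j) z
      - \sum_k dx k (fun y => u y 0 i) z * c z k j
      - \sum_k c z i k * dx k (fun y => u y 0 j) z
      = - (4 * K m * Hp m / xi m) * c z i j
        + 4 * kB m * theta m / xi m * (i == j)%:R)
  <-> 'D_((1, u z) : spacetime R d) c z = ucm_conformation_rate z.
Proof.
move=> Oz; have dcz := dc Oz.
have E i j : (dt (fun y => c y i j) z
      + \sum_k u z 0 k * dx k (fun y => c y i j) z
      - \sum_k dx k (fun y => u y 0 i) z * c z k j
      - \sum_k c z i k * dx k (fun y => u y 0 j) z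
      = - (4 * K m * Hp m / xi m) * c z i j
        + 4 * kB m * theta m / xi m * (i == j)%:R)
    <-> ('D_((1, u z) : spacetime R d) c z) i j = ucm_conformation_rate z i j.
  rewrite derive_mxE // material_derivativeE; last exact: differentiable_entry.
  have -> : ucm_conformation_rate z i j
      = \sum_k dx k (fun y => u y 0 i) z * c z k j
        + \sum_k c z i k * dx k (fun y => u y 0 j) z
        - 4 * K m * Hp m / xi m * c z i j
        + 4 * kB m * theta m / xi m * (i == j)%:R.
    rewrite !mxE; congr (_ + _ - _ + _); apply: eq_bigr => k _.
      by rewrite mxE.
    by rewrite !mxE.
  by split=> H; lra.
split=> [H|H i j]; first by apply/matrixP => i j; apply/E.
by apply/E; rewrite H.
Qed.

(** Conservation of mass makes the left side [rho D_t A], and positivity of [rho] lets it be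
    cancelled. *)
Lemma conservative_conformationP z : Om z -> mass z ->
  (forall al be : 'I_d,
      dt (fun y => rho y * A y al be) z
      + \sum_j dx j (fun y => rho y * u y 0 j * A y al be) z
      = 4 * rho z / xi m
        * (kB m * theta m
             * \sum_i invmx (F z) al i * invmx (F z) be i
           - K m * Hp m * A z al be))
  <-> 'D_((1, u z) : spacetime R d) A z
      = (4 * kB m * theta m / xi m) *: (invmx (F z) *m (invmx (F z))^T)
        - (4 * K m * Hp m / xi m) *: A z.
Proof.
move=> Oz mz; have dA := differentiable_pulled_back_conformation Oz.
have rho0 : rho z != 0 by rewrite gt_eqF // rho_gt0.
have E al be : (dt (fun y => rho y * A y al be) z
      + \sum_j dx j (fun y => rho y * u y 0 j * A y al be) z
      = 4 * rho z / xi m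
        * (kB m * theta m
             * \sum_i invmx (F z) al i * invmx (F z) be i
           - K m * Hp m * A z al be))
    <-> ('D_((1, u z) : spacetime R d) A z) al be
      = ((4 * kB m * theta m / xi m) *: (invmx (F z) *m (invmx (F z))^T)
        - (4 * K m * Hp m / xi m) *: A z) al be.
  rewrite transport_density //; [|exact: drho|exact: du|exact: differentiable_entry].
  rewrite derive_mxE //.
  have -> : ((4 * kB m * theta m / xi m) *: (invmx (F z) *m (invmx (F z))^T)
        - (4 * K m * Hp m / xi m) *: A z) al be
      = 4 * kB m * theta m / xi m * (\sum_i invmx (F z) al i * invmx (F z) be i)
        - 4 * K m * Hp m / xi m * A z al be.
    move: (A z) (invmx (F z)) => Az G; rewrite !mxE; congr (_ * _ - _).
    by apply: eq_bigr => i _; rewrite mxE.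
  split=> [H|->]; last by field.
  by apply: (mulfI rho0); rewrite H; field.
split=> [H|H al be]; first by apply/matrixP => al be; apply/E.
by apply/E; rewrite H.
Qed.

(* [F] is transported by the flow, so differentiating [c = F A F^T] turns the
   upper-convected derivative of [c] into [F (D_t A) F^T]. *)
Lemma conformation_rate_equiv z : Om z ->
  'D_((1, u z) : spacetime R d) c z = ucm_conformation_rate z
  <-> 'D_((1, u z) : spacetime R d) A z
      = (4 * kB m * theta m / xi m) *: (invmx (F z) *m (invmx (F z))^T)
        - (4 * K m * Hp m / xi m) *: A z.
Proof.
move=> Oz; have dA := differentiable_pulled_back_conformation Oz.
have Fu := F_unit Oz; have Ftu : (F z)^T \in unitmx by rewrite unitmx_tr.
have dFz := dF Oz.
have -> : 'D_((1, u z) : spacetime R d) c z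
    = velocity_gradient u z *m c z + c z *m (velocity_gradient u z)^T
      + F z *m 'D_((1, u z) : spacetime R d) A z *m (F z)^T.
  rewrite (@eq_on_derive _ _ _ Om c (fun y => F y *m A y *m (F y)^T)) //; last first.
    by move=> y Oy; rewrite pulled_back_conformationK.
  rewrite derive_mulmx; [|exact: differentiable_mulmx|exact: differentiable_trmx].
  rewrite derive_mulmx // derive_trmx // F_transported // mulmxDl trmx_mul.
  by rewrite addrAC -(pulled_back_conformationK Oz) !mulmxA.
(* Between [F] and [F^T], [F^-1 F^-T] becomes the identity and [A] becomes [c]; both rates then
   share their convected part. *)
have -> : ucm_conformation_rate z
    = velocity_gradient u z *m c z + c z *m (velocity_gradient u z)^T
      + F z *m ((4 * kB m * theta m / xi m) *: (invmx (F z) *m (invmx (F z))^T)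
        - (4 * K m * Hp m / xi m) *: A z) *m (F z)^T.
  rewrite /ucm_conformation_rate -!addrA; congr (_ + (_ + _)).
  rewrite mulmxBr mulmxBl -!scalemxAr -!scalemxAl pulled_back_conformationK //.
  by rewrite mulmxA mulmxV // mul1mx trmx_inv mulVmx // addrC.
split=> [/addrI H|-> //].
by apply: (can_inj (mulKmx Fu)); apply: (can_inj (mulmxK Ftu)).
Qed.

Lemma differentiable_conformation_stress z i j : Om z ->
  differentiable (fun y => stress m e0 (rho y) (c y) i j) z.
Proof.
move=> Oz; apply: differentiable_stress => //.
- exact: rho_gt0.
- exact: drho.
- exact: dc.
Qed.

(** [c] and [F A F^T] are known to agree on [Om] only; openness carries the equality over to
    derivatives. *)
Lemma derive_stress_pulled_back z v i j : Om z ->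
  'D_v (fun y => stress m e0 (rho y) (F y *m A y *m (F y)^T) i j) z
  = 'D_v (fun y => stress m e0 (rho y) (c y) i j) z.
Proof.
move=> Oz; apply: (eq_on_derive v Om_open Oz) => y Oy.
by rewrite pulled_back_conformationK.
Qed.

Lemma momentum_flux_split z i : Om z ->
  \sum_j dx j (fun y => rho y * u y 0 j * u y 0 i - stress m e0 (rho y) (c y) i j) z
  = \sum_j dx j (fun y => rho y * u y 0 j * u y 0 i) z
    - \sum_j dx j (fun y => stress m e0 (rho y) (F y *m A y *m (F y)^T) i j) z.
Proof.
move=> Oz; have drz := drho Oz; have duj k := differentiable_entry 0 k (du Oz).
rewrite -sumrB; apply: eq_bigr => j _.
have dflux : differentiable (fun y => rho y * u y 0 j * u y 0 i) z.
  by apply: differentiableM => //; exact: differentiableM.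
have dsig := differentiable_conformation_stress i j Oz.
by rewrite [LHS](derive_fB _ dflux dsig) -derive_stress_pulled_back.
Qed.

Lemma ucm_conservation_equiv :
  ucm_solution m e0 f Om u F rho c <-> conservation_law_solution m e0 f Om u F rho A.
Proof.
have Feq z i al : \sum_j dx j (fun y => rho y * u y 0 j * F y i al
                                         - rho y * F y j al * u y 0 i) z
    = \sum_j dx j (fun y => rho y * u y 0 j * F y i al
                            - rho y * u y 0 i * F y j al) z.
  apply: eq_bigr => j _; congr (dx j _ z); apply/funext => y.
  by rewrite [rho y * F y j al * _]mulrAC.
(* The mass equation belongs to both systems, so [mz] is available for the conformation equation in
   either direction. *)
split=> sol z Oz; have [mom Fev mz conf] := sol z Oz; split => //.
- by move=> i; rewrite -addrA -momentum_flux_split.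
- by move=> i al; rewrite -Feq.
- apply/(conservative_conformationP Oz mz)/(conformation_rate_equiv Oz).
  exact/(ucm_conformationP Oz).
- by move=> i; rewrite momentum_flux_split // addrA.
- by move=> i al; rewrite Feq.
- apply/(ucm_conformationP Oz)/(conformation_rate_equiv Oz).
  exact/(conservative_conformationP Oz mz).
Qed.

(** Specific energy written through [c], so that its derivative calls for that of [c] rather than
    those of [F] and [A]. *)
Let e z := (\sum_i u z 0 i ^+ 2) / 2
  + (e0 (rho z) + K m * Hp m * \tr (c z) - kB m * theta m * ln (\det (c z))).

Lemma total_energyE z : Om z -> total_energy m e0 u F rho A z = rho z * e z.
Proof. by move=> Oz; rewrite /total_energy free_energyE pulled_back_conformationK. Qed.

Let dusq z i : Om z -> differentiable (fun y => u y 0 i ^+ 2) z.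
Proof.
move=> Oz; have dui := differentiable_entry 0 i (du Oz).
exact: (@differentiableX _ _ (fun y => u y 0 i) 1).
Qed.

Let dkin z : Om z -> differentiable (fun y => \sum_i u y 0 i ^+ 2) z.
Proof. by move=> Oz; apply: differentiable_fsum => i _; exact: dusq. Qed.

Let de0 z : Om z -> differentiable (fun y => e0 (rho y)) z.
Proof.
move=> Oz; apply: (@differentiable_comp _ _ _ _ rho e0); first exact: drho.
exact: smooth_on_differentiable e0_smooth (rho_gt0 Oz).
Qed.

Let dlndet z : Om z -> differentiable (fun y => ln (\det (c y))) z.
Proof.
move=> Oz; apply: (@differentiable_comp _ _ _ _ (fun y => \det (c y)) (@ln R)).
  exact/differentiable_det/dc.
exact/differentiable_ln/spd_det_gt0/c_spd.
Qed.

Let dcst (k : R) z : differentiable (fun _ : spacetime R d => k) z.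
Proof. exact: differentiable_cst. Qed.

Let dtr z : Om z -> differentiable (fun y => \tr (c y)) z.
Proof. by move=> Oz; exact/differentiable_trace/dc. Qed.

Let dpot z : Om z -> differentiable (fun y =>
  e0 (rho y) + K m * Hp m * \tr (c y) - kB m * theta m * ln (\det (c y))) z.
Proof.
move=> Oz; apply: differentiableB.
  apply: differentiableD; first exact: de0.
  by apply: differentiableM => //; exact: dtr.
by apply: differentiableM => //; exact: dlndet.
Qed.

Let de z : Om z -> differentiable e z.
Proof.
move=> Oz; apply: differentiableD; last exact: dpot.
by apply: differentiableM => //; exact: dkin.
Qed.

Lemma derive_specific_energy z v : Om z ->
  'D_v e z = \sum_i u z 0 i * 'D_v (fun y => u y 0 i) z
    + ('D_v rho z * 'D_1 e0 (rho z) + (K m * Hp m * \tr ('D_v c z)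
       - kB m * theta m * \tr (invmx (c z) *m 'D_v c z))).
Proof.
move=> Oz; have dui i := differentiable_entry 0 i (du Oz).
have [dcz [dtrz dlnz]] := (dc Oz, (dtr Oz, dlndet Oz)).
have dkt : differentiable (fun y => K m * Hp m * \tr (c y)) z by apply: differentiableM.
have dkl : differentiable (fun y => kB m * theta m * ln (\det (c y))) z.
  by apply: differentiableM.
rewrite /e derive_fD; [|by apply: differentiableM => //; exact: dkin|exact: dpot].
congr (_ + _).
  rewrite derive_fM //; last exact: dkin.
  rewrite derive_cst mulr0 addr0 derive_fsum; last by move=> i _; exact: dusq.
  rewrite big_distrl; apply: eq_bigr => i _ /=.
  under eq_fun do rewrite expr2.
  by rewrite derive_fM //; field.
rewrite derive_fB //; last by apply: differentiableD => //; exact: de0.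
rewrite derive_fD //; last exact: de0.
rewrite !derive_fMl // derive_trace // derive_lndet //; last exact/spd_det_gt0/c_spd.
rewrite addrA; congr (_ + _ - _).
rewrite (@derive_fcomp _ _ _ _ rho e0); last 2 first.
- exact: drho.
- exact: smooth_on_differentiable e0_smooth (rho_gt0 Oz).
rewrite -['D_v rho z in LHS]mulr1 derive_dirZ //.
exact: smooth_on_differentiable e0_smooth (rho_gt0 Oz).
Qed.

Lemma ucm_energy_balance :
  ucm_solution m e0 f Om u F rho c -> energy_balance m e0 f Om u F rho A.
Proof.
move=> sol z Oz /=; have [mom _ mz conf] := sol z Oz.
have dui i := differentiable_entry 0 i (du Oz).
have dsig i j := differentiable_conformation_stress i j Oz.
have [drz [duz dcz]] := (drho Oz, (du Oz, dc Oz)).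
have rz := rho_gt0 Oz.
move/(ucm_conformationP Oz) : conf => conf.
set W : spacetime R d := (1, u z) in conf *.
set L := velocity_gradient u z.
(* Momentum in nonconservative form, to be multiplied by [u] and summed. *)
have momW i : rho z * 'D_W (fun y => u y 0 i) z
    - \sum_j dx j (fun y => stress m e0 (rho y) (c y) i j) z = rho z * f z 0 i.
  rewrite -mom (momentum_flux_split i Oz) addrA.
  rewrite (transport_density drz duz (dui i) mz); congr (_ - _).
  by apply: eq_bigr => j _; rewrite /dx derive_stress_pulled_back.
have LE i j : L i j = dx j (fun y => u y 0 i) z by rewrite mxE.
have divE : \sum_j dx j (fun y => u y 0 j) z = \tr L.
  by apply: eq_bigr => j _; rewrite mxE.
have massW := mass_material_derivative drz duz mz; rewrite -/W divE in massW.
(* On [Om] the energy is [rho * e], so conservation of mass reduces both transport terms to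
   [rho D_t e]. *)
have -> : dt (total_energy m e0 u F rho A) z
    + \sum_j dx j (fun y => u y 0 j * total_energy m e0 u F rho A y) z
    = rho z * 'D_W e z.
  rewrite -(transport_density drz duz (de Oz) mz); congr (_ + _).
    by apply: (eq_on_derive _ Om_open Oz) => y Oy; rewrite total_energyE.
  apply: eq_bigr => j _; apply: (eq_on_derive _ Om_open Oz) => y Oy.
  by rewrite total_energyE // mulrA [u y 0 j * _]mulrC.
(* By the product rule the work of the stress splits into [L : sigma] and [u . div sigma]. *)
have -> : \sum_j dx j (fun y => \sum_i u y 0 i
      * stress m e0 (rho y) (F y *m A y *m (F y)^T) i j) z
    = \sum_j \sum_i L i j * stress m e0 (rho z) (c z) i j
      + \sum_i u z 0 i * (\sum_j dx j (fun y => stress m e0 (rho y) (c y) i j) z).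
  under [X in _ = _ + X]eq_bigr do rewrite big_distrr.
  rewrite [X in _ = _ + X]exchange_big -big_split; apply: eq_bigr => j _ /=.
  rewrite -big_split [LHS](eq_on_derive (g := fun y => \sum_i u y 0 i
      * stress m e0 (rho y) (c y) i j) _ Om_open Oz); last first.
    by move=> y Oy; rewrite pulled_back_conformationK.
  rewrite derive_fsum; last by move=> i _; exact: differentiableM.
  by apply: eq_bigr => i _; rewrite LE /dx derive_fM.
rewrite derive_specific_energy // massW pulled_back_conformationK //.
rewrite (free_energy_production (c_spd Oz) xi_neq0 conf) -/L.
rewrite stress_power; last exact: (c_spd Oz).1.
(* With [p = rho ^ 2 e0'], the term [rho e0' D_t rho] is [- p tr L] and cancels against the pressure
   part of the stress power. *)
rewrite pressureE //; last first.
  by move=> s s0; exact: smooth_on_differentiable e0_smooth s0.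
have -> : \sum_i rho z * f z 0 i * u z 0 i
    = rho z * (\sum_i u z 0 i * 'D_W (fun y => u y 0 i) z)
      - \sum_i u z 0 i * (\sum_j dx j (fun y => stress m e0 (rho y) (c y) i j) z).
  rewrite big_distrr -sumrB; apply: eq_bigr => i _ /=.
  by rewrite -momW; ring.
by field.
Qed.

End MaxwellModel.

Theorem proposition3p2 (R : realType) (d : nat) (d23 : d = 2%N \/ d = 3%N)
    (m : maxwell_constants R) (m_gt0 : positive_constants m)
    (rhohat : R) (rhohat_gt0 : 0 < rhohat)
    (e0 : R -> R) (e0_smooth : smooth_on [set r : R | 0 < r] e0)
    (J : set R) (B : set 'rV[R]_d)
    (phi phinv : R * 'rV[R]_d -> 'rV[R]_d)
    (phi_motion : smooth_motion J B phi phinv)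
    (f : R * 'rV[R]_d -> 'rV[R]_d)
    (f_smooth : forall i, smooth_on (occupied J B phi) (fun z => f z 0 i))
    (c : R * 'rV[R]_d -> 'M[R]_d)
    (c_smooth : forall i j, smooth_on (occupied J B phi) (fun z => c z i j))
    (c_spd : forall z, occupied J B phi z -> spd (c z)) :
  let Om := occupied J B phi in
  let u := velocity phi phinv in
  let F := deformation_gradient phi phinv in
  let rho := mass_density rhohat phi phinv in
  let A := pulled_back_conformation F c in
  [/\ (forall z, Om z -> spd (A z) /\ c z = F z *m A z *m (F z)^T),
      (ucm_solution m e0 f Om u F rho c
         <-> conservation_law_solution m e0 f Om u F rho A),
      (ucm_solution m e0 f Om u F rho c ->
         energy_balance m e0 f Om u F rho A)
    & (forall z, Om z -> [/\
         free_energy m e0 (rho z) (F z) (A z)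
           = free_energy_of_density m e0 rhohat (rho z) (F z) (A z),
         free_energy m e0 (rho z) (F z) (A z)
           = free_energy_of_strain m e0 (rho z) (A z) ((F z)^T *m F z),
         stress m e0 (rho z) (c z)
           = hyperelastic_stress m e0 (rho z) (F z) (A z)
       & 0 <= dissipation m (c z)])].
Proof.
move=> Om u F rho A.
have xi0 : xi m != 0 by case: m_gt0 => _ _ _ _ xi0; rewrite gt_eqF.
have Om_open : open Om := motion_range_open phi_motion.
have detF z : Om z -> 0 < \det (F z) by exact: deformation_gradient_det_gt0.
have Fu z : Om z -> F z \in unitmx by exact: deformation_gradient_unit.
have du z : Om z -> differentiable u z by exact: differentiable_velocity.
have dF z : Om z -> differentiable F z by exact: differentiable_deformation_gradient.
have dc z : Om z -> differentiable c z.
  move=> Oz; apply: differentiable_mx => i j.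
  exact: smooth_on_differentiable (c_smooth i j) Oz.
have rho0 z : Om z -> 0 < rho z by move=> Oz; rewrite divr_gt0 // detF.
have drho z : Om z -> differentiable rho z.
  move=> Oz; apply: differentiableM; first exact: differentiable_cst.
  apply: differentiableV; last by rewrite gt_eqF // detF.
  exact/differentiable_det/dF.
have FT z : Om z -> 'D_((1, u z) : spacetime R d) F z = velocity_gradient u z *m F z.
  exact: material_derivative_gradient phi_motion z.
have cE z : Om z -> F z *m A z *m (F z)^T = c z by exact: pulled_back_conformationK.
have A_spd z : Om z -> spd (A z).
  by move=> Oz; apply: spd_congr (c_spd z Oz) _; rewrite unitmx_inv Fu.
split.
- by move=> z Oz; split; [exact: A_spd | rewrite cE].
- exact: ucm_conservation_equiv.
- exact: ucm_energy_balance.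
(* The logarithms of determinants call for [det A] to be strictly positive. *)
move=> z Oz; have A0 := spd_det_gt0 (A_spd z Oz); split.
- by rewrite /rho /mass_density free_energy_density // detF.
- exact: free_energy_strain.
- by rewrite -(cE z Oz) stress_hyperelastic // detF.
- exact/dissipation_ge0/c_spd.
Qed.
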